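(* If $T$ is any tree except $P_4$ and $P_5$, then $q(T)+q(T^c)\le |T|+2$.
   Context: All graphs are finite, undirected and simple; isomorphic graphs are identified; $|G|$ is the number of vertices of $G$, and $G^c$ is the complement of $G$. For a graph $G$ with vertex set $\{1,\dots,n\}$, $S(G)$ is the set of all real symmetric $n\times n$ matrices $A=(a_{ij})$ such that for $i\ne j$, $a_{ij}\neq 0$ if and only if $\{i,j\}$ is an edge of $G$ (no restriction on the diagonal). $q(A)$ is the number of distinct eigenvalues of $A$, and $q(G)=\min\{q(A): A\in S(G)\}$. $P_n$ is the path on $n$ vertices. *)

(* Defs.v *)
From mathcomp Require Import all_boot all_order all_algebra finmap.
From mathcomp Require Import boolp classical_sets functions cardinality reals.

Set Implicit Arguments.
Unset Strict Implicit.
Unset Printing Implicit Defensive.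

Import Order.TTheory GRing.Theory Num.Theory.
Local Open Scope classical_set_scope.
Local Open Scope ring_scope.

Record sgraph (n : nat) := SGraph {
  edge :> rel 'I_n;
  edge_sym : symmetric edge;
  edge_irrefl : irreflexive edge }.

Definition order_of (n : nat) (G : sgraph n) : nat := n.

Definition isomorphic (n m : nat) (G : sgraph n) (H : sgraph m) : Prop :=
  exists2 f : 'I_n -> 'I_m, bijective f & forall x y, H (f x) (f y) = G x y.

Section Complement.
Variables (n : nat) (G : sgraph n).

Definition compl_rel : rel 'I_n := fun x y => (x != y) && ~~ G x y.

Lemma compl_rel_sym : symmetric compl_rel.
Proof. by move=> x y; rewrite /compl_rel eq_sym edge_sym. Qed.

Lemma compl_rel_irrefl : irreflexive compl_rel.
Proof. by move=> x; rewrite /compl_rel eqxx. Qed.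

Definition compl : sgraph n := SGraph compl_rel_sym compl_rel_irrefl.
End Complement.

Section PathGraph.
Variable n : nat.

Definition path_rel : rel 'I_n :=
  fun x y => (x.+1 == y :> nat) || (y.+1 == x :> nat).

Lemma path_rel_sym : symmetric path_rel.
Proof. by move=> x y; rewrite /path_rel orbC. Qed.

Lemma path_rel_irrefl : irreflexive path_rel.
Proof. by move=> x; rewrite /path_rel gtn_eqF. Qed.

Definition path_graph : sgraph n := SGraph path_rel_sym path_rel_irrefl.
End PathGraph.

Definition connected_graph (n : nat) (G : sgraph n) : Prop :=
  (0 < n)%N /\ forall x y, connect G x y.

(* [ucycle] also accepts the sequences [:: x; y] with x, y adjacent, hence the
   bound on the size. *)
Definition acyclic (n : nat) (G : sgraph n) : Prop :=
  forall c : seq 'I_n, (2 < size c)%N -> ~ ucycle G c.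

Definition is_tree (n : nat) (G : sgraph n) : Prop :=
  connected_graph G /\ acyclic G.

Section DistinctEigenvalues.
Variable R : realType.

Definition eigenvalues (n : nat) (A : 'M[R]_n) : set R :=
  [set a | eigenvalue A a].

Lemma finite_eigenvalues (n : nat) (A : 'M[R]_n) : finite_set (eigenvalues A).
Proof.
have pA0 : char_poly A != 0 by rewrite monic_neq0 ?char_poly_monic.
have [s /allP s_roots max_s] : exists2 s : seq R, all (root (char_poly A)) s &
    forall a, root (char_poly A) a -> a \in s.
  have [N] := ubnP (size (char_poly A)).
  elim: N (char_poly A) pA0 => // N IHN p p0 szp.
  have [[a pa]|noroot] := pselect (exists a, root p a); last first.
    by exists [::] => // a pa; case: noroot; exists a.
  have [q pE] := factor_theorem p a pa.
  have q0 : q != 0 by apply: contraNneq p0 => q0; rewrite pE q0 mul0r.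
  have szq : (size q < N)%N.
    by move: szp; rewrite pE size_Mmonic ?monicXsubC // size_XsubC addn2.
  have [s qs smax] := IHN q q0 szq.
  exists (a :: s); rewrite /=.
    rewrite pa; apply/allP => b /(allP qs) qb.
    by rewrite pE rootM qb.
  move=> b; rewrite pE rootM root_XsubC inE => /orP[/smax ->|->//].
  by rewrite orbT.
apply: (sub_finite_set _ (finite_seq s)) => a /=.
by rewrite /eigenvalues /= eigenvalue_root_char; apply: max_s.
Qed.

(* [fset_set] is the finite set with the same elements; its default value on
   infinite sets is never reached, by [finite_eigenvalues]. *)
Definition q_mx (n : nat) (A : 'M[R]_n) : nat :=
  #|` fset_set (eigenvalues A)|%fset.

Definition S_graph (n : nat) (G : sgraph n) : set 'M[R]_n :=
  [set A | A^T = A /\ forall i j, i != j -> (A i j != 0 <-> G i j)].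

Lemma q_graph_exists (n : nat) (G : sgraph n) :
  exists k, `[< (@q_mx n @` S_graph G) k >].
Proof.
pose A : 'M[R]_n := \matrix_(i, j) (G i j)%:R.
exists (q_mx A); apply/asboolP; exists A => //; split=> [|i j _].
  by apply/matrixP => i j; rewrite !mxE edge_sym.
by rewrite mxE; case: (G i j); rewrite ?oner_eq0 ?eqxx.
Qed.

Definition q_graph (n : nat) (G : sgraph n) : nat := ex_minn (q_graph_exists G).
End DistinctEigenvalues.

Arguments S_graph R {n} G.
Arguments q_graph R {n} G.

(* Main.v *)
Require Import Defs.
From mathcomp Require Import all_boot all_order all_algebra.
From mathcomp Require Import reals.
From mathcomp Require Import finmap boolp classical_sets cardinality.
From mathcomp Require Import ring lra zify.

(** Let [n] be the order of the tree [T]. Always q(T) <= n, so it is enough to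
bound q of the complement, gaining 1 on the side of [T] when necessary.

A matrix of the complement of [T] is obtained as a Gram matrix: choose vectors
v_i in R^3, one for each vertex, such that distinct v_i and v_j are orthogonal
exactly when i and j are adjacent in [T]. For all positive weights c_i, the
Gram matrix of the vectors sqrt(c_i) v_i has the pattern of the complement, and
its eigenvalues are 0 and those of the 3 x 3 frame operator
F = sum_i c_i v_i^T v_i. Hence q <= 2 if F is scalar, and q <= 3 if F is scalar
plus rank one ([q_graph_frame]).

Such vectors can be chosen greedily along a tree, pairwise independent: a new
vertex has exactly one neighbour y among those already treated, and a generic
vector of the plane orthogonal to v_y is orthogonal to none of the others
([orthorep_total]). So only a small subtree, the base, needs explicit vectors.
The base also corrects the frame operator: whatever symmetric matrix E the other
vertices contribute, its weights are chosen so that E plus its own contribution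
has the required form ([q_compl_of_base]). Two bases are used.

- The path on 6 vertices, with explicit vectors for which the six matrices
  v_k^T v_k form a basis of the symmetric matrices in which the identity has
  positive coordinates. Then a I - E also has positive coordinates for a large,
  which makes F scalar ([path_cone]).

- The claw. Its centre contributes to the entry (0,0) only, and its three
  leaves span the symmetric matrices of the orthogonal plane. They cannot reach
  the entries (0,1) and (0,2) of E, but the rank-one matrix w^T w with
  w = (1, E_01, E_02) has the same ones, so that F is scalar plus w^T w
  ([claw_cone]).

A tree either is a path or contains a claw ([path_or_claw]). If it contains a
claw with centre u, the Laplacian matrix of T - u, bordered by minus the
adjacency vector of u, has a kernel of dimension at least 2: it contains the
differences of the indicators of the branches at u. Thus q(T) <= n - 1
([q_lt_order_of_claw]) while q of the complement is at most 3. A path on at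
least 6 vertices contains the first base, hence has 2 for its complement. The
path on 3 vertices is a star, and its complement supports a matrix of rank one;
for at most 2 vertices the trivial bounds suffice. *)

Set Implicit Arguments.
Unset Strict Implicit.
Unset Printing Implicit Defensive.

Import Order.TTheory GRing.Theory Num.Theory.
Local Open Scope ring_scope.

(** * Counting eigenvalues; Gram matrices *)

Section Spectra.
Variable R : realType.

Lemma q_mx_le_size n (A : 'M[R]_n) (s : seq R) :
  (forall a, eigenvalue A a -> a \in s) -> (q_mx A <= size s)%N.
Proof.
move=> As; rewrite /q_mx.
have /fsubset_leq_card/leq_trans -> // :
    (fset_set (eigenvalues A) `<=` [fset a in s])%fset.
  apply/fsubsetP => a; rewrite in_fset_set; last exact: finite_eigenvalues.
  by rewrite !inE => /As.
by rewrite card_fseq size_undup.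
Qed.

Lemma q_graph_le n (G : sgraph n) (A : 'M[R]_n) :
  S_graph R G A -> (q_graph R G <= q_mx A)%N.
Proof.
move=> GA; rewrite /q_graph; case: ex_minnP => m _; apply.
by apply/asboolP; exists A.
Qed.

Lemma sum_eigenspaces n (A : 'M[R]_n) (s : seq R) : uniq s ->
  (\sum_(a <- s) \rank (eigenspace A a) <= n)%N.
Proof.
move=> us.
have : mxdirect (\sum_(i < size s) eigenspace A s`_i)%MS.
  apply: mxdirect_sum_eigenspace => i j _ _ /eqP.
  by rewrite nth_uniq // => /eqP; exact: val_inj.
rewrite (big_nth 0) big_mkord => /mxdirectP /= <-; exact: rank_leq_col.
Qed.

(** The eigenspaces are in direct sum, and each of the other eigenvalues takes
at least one dimension. *)
Lemma q_mx_eigenspaces n (A : 'M[R]_n) (a : R) :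
  eigenvalue A a -> (q_mx A + \rank (eigenspace A a) <= n.+1)%N.
Proof.
move=> Aa; rewrite /q_mx.
set s := fset_set _.
have sE b : (b \in s) = eigenvalue A b.
  rewrite in_fset_set; last exact: finite_eigenvalues.
  by apply/idP/idP; rewrite inE.
have := sum_eigenspaces A (fset_uniq s).
rewrite (big_rem a) /= ?sE// => le_n.
have : (size (rem a s) <= \sum_(b <- rem a s) \rank (eigenspace A b))%N.
  rewrite -sum1_size big_seq [X in (_ <= X)%N]big_seq; apply: leq_sum => b.
  by move=> /mem_rem; rewrite sE lt0n mxrank_eq0.
have s_gt0 : (0 < #|` s|)%N.
  by rewrite cardfs_gt0; apply/fset0Pn; exists a; rewrite sE.
rewrite size_rem ?sE// -[size s]/(#|` s|%fset); move=> le_s.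
have := leq_trans (leq_add (leqnn _) le_s) le_n; lia.
Qed.

Lemma q_mx_le n (A : 'M[R]_n) : (q_mx A <= n)%N.
Proof.
have [[a Aa]|noA] := pselect (exists a, eigenvalue A a).
  have := q_mx_eigenspaces Aa; have: (0 < \rank (eigenspace A a))%N.
    by rewrite lt0n mxrank_eq0.
  lia.
apply: leq_trans (@q_mx_le_size _ A [::] _) _ => // a Aa.
by case: noA; exists a.
Qed.

Lemma q_graph_le_order n (G : sgraph n) : (q_graph R G <= n)%N.
Proof.
rewrite /q_graph; case: ex_minnP => m /asboolP[A _ <-] _; exact: q_mx_le.
Qed.

(** [x |-> x V] maps eigenvectors of [V V^T] to eigenvectors of [V^T V], unless
it sends them to 0. *)
Lemma eigenvalue_gram n d (V : 'M[R]_(n, d)) a :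
  eigenvalue (V *m V^T) a -> a = 0 \/ eigenvalue (V^T *m V) a.
Proof.
move=> /eigenvalueP[y yE y0]; have [->|a0] := eqVneq a 0; [by left|right].
apply/eigenvalueP; exists (y *m V).
  by rewrite scalemxAl -yE !mulmxA.
apply: contraNneq y0 => yV0; rewrite mulmxA yV0 mul0mx in yE.
by rewrite -(scalerK a0 y) -yE scaler0.
Qed.

(** Pairing an eigenvector x with w: either x w^T = 0 and the rank-one part does
not act on x, or x w^T can be cancelled. *)
Lemma eigenvalue_scalar_rank1 d (al : R) (w : 'rV[R]_d) a :
  eigenvalue (al%:M + w^T *m w) a -> a \in [:: al; al + (w *m w^T) 0 0].
Proof.
move=> /eigenvalueP[x]; rewrite mulmxDr mul_mx_scalar mulmxA.
rewrite (mx11_scalar (x *m w^T)) mul_scalar_mx; set b := (x *m w^T) 0 0.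
move=> xE x0; rewrite !inE.
have xwE : al * b + b * (w *m w^T) 0 0 = a * b.
  have /(congr1 (fun z => (z *m w^T) 0 0)) := xE.
  by rewrite mulmxDl -!scalemxAl /b !mxE.
have [b0|bn0] := eqVneq b 0.
  move: xE; rewrite b0 scale0r addr0 => /eqP.
  rewrite -subr_eq0 -scalerBl scaler_eq0 (negPf x0) orbF subr_eq0.
  by rewrite eq_sym => ->.
apply/orP; right; apply/eqP/(mulIf bn0); rewrite -xwE; ring.
Qed.

Definition dot d (u v : 'rV[R]_d) : R := (u *m v^T) 0 0.

(** The sum on the left of the last hypothesis is V^T V for the matrix V with
rows sqrt(c_i) v_i, and V V^T is in [S_graph R G]. *)
Lemma q_graph_frame n (G : sgraph n) d (v : 'I_n -> 'rV[R]_d) (c : 'I_n -> R)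
    (al : R) (w : 'rV[R]_d) :
  (forall i j, i != j -> (dot (v i) (v j) != 0) = G i j) ->
  (forall i, 0 < c i) ->
  \sum_i c i *: ((v i)^T *m v i) = al%:M + w^T *m w ->
  (q_graph R G <= 2 + (w != 0%R))%N.
Proof.
move=> vG c0 vF.
pose V : 'M[R]_(n, d) := \matrix_i (Num.sqrt (c i) *: v i).
have FE : V^T *m V = al%:M + w^T *m w.
  rewrite -vF; apply/matrixP => k l; rewrite mxE summxE; apply: eq_bigr => i _.
  rewrite !mxE big_ord1 !mxE mulrACA -expr2 sqr_sqrtr ?ltW//.
have GA : S_graph R G (V *m V^T).
  split; first by rewrite trmx_mul trmxK.
  move=> i j ij; rewrite -vG//.
  have -> : (V *m V^T) i j = Num.sqrt (c i) * Num.sqrt (c j) * dot (v i) (v j).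
    rewrite /dot !mxE big_distrr; apply: eq_bigr => k _ /=.
    by rewrite !mxE mulrACA.
  have s0 k : Num.sqrt (c k) != 0 by rewrite gt_eqF ?sqrtr_gt0.
  by rewrite !mulf_eq0 !negb_or !s0.
apply: leq_trans (q_graph_le GA) _.
pose s := if w == 0 then [:: 0; al] else [:: 0; al; al + (w *m w^T) 0 0].
have -> : (2 + (w != 0%R))%N = size s by rewrite /s; case: ifP.
apply: q_mx_le_size => a /eigenvalue_gram[->|].
  by rewrite /s; case: ifP; rewrite inE eqxx.
rewrite FE => /eigenvalue_scalar_rank1; rewrite /s.
case: eqP => [->|_]; rewrite !inE; last by move=> ->; rewrite orbT.
by rewrite mul0mx mxE addr0 orbb => ->; rewrite orbT.
Qed.
End Spectra.

(** * Vectors of dimension 3 *)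

Section Vectors.
Variable R : realType.

Lemma nonroot_exists (p : {poly R}) : p != 0 -> exists t, ~~ root p t.
Proof.
move=> p0; apply: contrapT => /forallNP rp.
pose s : seq R := [seq i%:R | i <- iota 0 (size p)].
have : (size s < size p)%N.
  apply: max_poly_roots => //.
    by apply/allP => t _; apply/negPn/negP; exact: rp.
  by rewrite map_inj_uniq ?iota_uniq//; exact: mulrIn (oner_neq0 R).
by rewrite size_map size_iota ltnn.
Qed.

(** On the moment curve t |-> (1, t, t^2, ...), the scalar product with a nonzero
vector is a nonzero polynomial in t. *)
Lemma generic_vector d (us : seq 'rV[R]_d) : (forall u, u \in us -> u != 0) ->
  exists g : 'rV[R]_d, forall u, u \in us -> dot u g != 0.
Proof.
move=> us0; have [|t tP] := @nonroot_exists (\prod_(u <- us) rVpoly u).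
  rewrite prodf_seq_neq0; apply/allP => u /us0; apply: contraNneq => u0.
  by rewrite -[u]rVpolyK u0 linear0.
exists (\row_k t ^+ k) => u uus.
have -> : dot u (\row_k t ^+ k) = (rVpoly u).[t].
  rewrite /dot mxE horner_poly; apply: eq_bigr => k _.
  by rewrite !mxE valK.
apply: contraNneq tP => ut; rewrite /root horner_prod.
by rewrite prodf_seq_eq0; apply/hasP; exists u => //; rewrite ut eqxx.
Qed.

(** The vector product; the indices are added in Z/3. *)
Definition cross (u v : 'rV[R]_3) : 'rV[R]_3 :=
  \row_k (u 0 (k + 1) * v 0 (k + 2) - u 0 (k + 2) * v 0 (k + 1)).

Lemma dot3E (u v : 'rV[R]_3) :
  dot u v = u 0 0 * v 0 0 + u 0 1 * v 0 1 + u 0 2 * v 0 2.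
Proof.
rewrite /dot mxE !big_ord_recl big_ord0 addr0 addrA !mxE.
by congr (_ * _ + _ * _ + _ * _); congr (_ _ _); apply: val_inj.
Qed.

Lemma row3P (u v : 'rV[R]_3) :
  u 0 0 = v 0 0 -> u 0 1 = v 0 1 -> u 0 2 = v 0 2 -> u = v.
Proof.
move=> e0 e1 e2; apply/rowP => k.
have : [|| k == 0, k == 1 | k == 2] by case: k => [[|[|[|]]]].
by case/or3P => /eqP ->.
Qed.

Lemma crossE (u v : 'rV[R]_3) :
  [/\ cross u v 0 0 = u 0 1 * v 0 2 - u 0 2 * v 0 1,
      cross u v 0 1 = u 0 2 * v 0 0 - u 0 0 * v 0 2
    & cross u v 0 2 = u 0 0 * v 0 1 - u 0 1 * v 0 0].
Proof.
have I3 : [/\ 1 + 1 = 2 :> 'I_3, 1 + 2 = 0 :> 'I_3,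
  2 + 1 = 0 :> 'I_3 & 2 + 2 = 1 :> 'I_3].
  by split; apply: val_inj.
case: I3 => E11 E12 E21 E22.
by rewrite !mxE !add0r E11 E12 E21 E22.
Qed.

Lemma crossC u v : cross v u = - cross u v.
Proof.
have [e0 e1 e2] := crossE u v; have [f0 f1 f2] := crossE v u.
by apply: row3P; rewrite [RHS]mxE ?e0 ?f0 ?e1 ?f1 ?e2 ?f2; ring.
Qed.

Lemma dotC d (u v : 'rV[R]_d) : dot u v = dot v u.
Proof. by rewrite /dot -[u *m _]trmxK trmx_mul trmxK mxE. Qed.

Lemma dot_cross_self u g : dot u (cross u g) = 0.
Proof. by have [e0 e1 e2] := crossE u g; rewrite dot3E e0 e1 e2; ring. Qed.

Lemma dot_cross_rot u v g : dot (cross u g) v = dot (cross v u) g.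
Proof.
have [e0 e1 e2] := crossE u g; have [f0 f1 f2] := crossE v u.
by rewrite !dot3E e0 e1 e2 f0 f1 f2; ring.
Qed.

(** Exhibits a multiple of u x g as a product with (u x g) x v, which is then
nonzero when the multiple is: see [cross_cross_neq0]. *)
Lemma cross_cross_cross u v g :
  cross (cross (cross u g) v) g = - dot g v *: cross u g.
Proof.
have [e0 e1 e2] := crossE u g; have [f0 f1 f2] := crossE (cross u g) v.
have [g0 g1 g2] := crossE (cross (cross u g) v) g.
apply: row3P; rewrite [RHS]mxE ?g0 ?g1 ?g2 ?f0 ?f1 ?f2 ?e0 ?e1 ?e2 dot3E.
all: by ring.
Qed.

Lemma cross0v v : cross 0 v = 0.
Proof. by apply/rowP => k; rewrite !mxE !mul0r subrr. Qed.

Lemma cross_cross_neq0 u v g :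
  dot v g != 0 -> cross u g != 0 -> cross (cross u g) v != 0.
Proof.
move=> vg ug; apply: contraNneq vg => uv0.
have := cross_cross_cross u v g; rewrite uv0 cross0v dotC => /esym/eqP.
by rewrite scaler_eq0 (negPf ug) orbF oppr_eq0.
Qed.

Definition vec3 (a b c : R) : 'rV[R]_3 := \row_k [:: a; b; c]`_k.

Lemma vec3E a b c :
  (vec3 a b c 0 0 = a) * (vec3 a b c 0 1 = b) * (vec3 a b c 0 2 = c).
Proof. by rewrite !mxE. Qed.

Definition weighted_frame (cs : seq R) (vs : seq 'rV[R]_3) : 'M[R]_3 :=
  \sum_(k < size vs) cs`_k *: ((vs`_k)^T *m vs`_k).

Lemma weighted_frameE cs vs i j : weighted_frame cs vs i j =
  \sum_(k < size vs) cs`_k * (vs`_k 0 i * vs`_k 0 j).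
Proof.
by rewrite summxE; apply: eq_bigr => k _; rewrite !mxE big_ord1 !mxE.
Qed.

Lemma weighted_frame_sym cs vs :
  (weighted_frame cs vs)^T = weighted_frame cs vs.
Proof.
apply/matrixP => i j; rewrite mxE !weighted_frameE; apply: eq_bigr => k _.
by rewrite [X in _ * X]mulrC.
Qed.

(** Vectors for the vertices of the path on 6 vertices, in their order along it.
Only consecutive vectors are orthogonal ([path_vecsP]), and the identity has
positive coordinates in the basis of the products v^T v, which is what
[path_cone] needs. *)
Definition path_vecs : seq 'rV[R]_3 :=
  [:: vec3 1 1 0; vec3 1 (-1) (-1); vec3 0 1 (-1);
      vec3 1 0 0; vec3 0 1 0; vec3 1 0 2].

(** Vectors for a leaf, the centre, and the other two leaves of a claw. *)
Definition claw_vecs : seq 'rV[R]_3 :=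
  [:: vec3 0 2 (-1); vec3 1 0 0; vec3 0 2 1; vec3 0 0 1].

Lemma sym3P (A B : 'M[R]_3) : A^T = A -> B^T = B ->
  A 0 0 = B 0 0 -> A 1 1 = B 1 1 -> A 2 2 = B 2 2 ->
  A 0 1 = B 0 1 -> A 0 2 = B 0 2 -> A 1 2 = B 1 2 -> A = B.
Proof.
move=> As Bs e00 e11 e22 e01 e02 e12; apply/matrixP => i j.
have I3 (k : 'I_3) : [|| k == 0, k == 1 | k == 2] by case: k => [[|[|[|]]]].
have sA k l : A k l = A l k by rewrite -{1}As mxE.
have sB k l : B k l = B l k by rewrite -{1}Bs mxE.
case/or3P: (I3 i) => /eqP ->; case/or3P: (I3 j) => /eqP -> //.
all: by rewrite sA sB.
Qed.

Lemma entries_bounded m n (N : 'M[R]_(m, n)) :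
  exists B, forall i j, - B <= N i j <= B.
Proof.
exists (\sum_i \sum_j `|N i j|) => i j; rewrite -ler_norml.
rewrite (bigD1 i)//= (bigD1 j)//= -addrA lerDl addr_ge0 ?sumr_ge0// => k _.
by rewrite sumr_ge0.
Qed.

Lemma scalar_add_sym (N : 'M[R]_3) al : N^T = N -> (al%:M + N)^T = al%:M + N.
Proof. by move=> Ns; rewrite linearD /= tr_scalar_mx Ns. Qed.

(** Some multiple of the identity brings any symmetric matrix into the open cone
spanned by the six matrices of [path_vecs]. *)
Lemma path_cone (N : 'M[R]_3) : N^T = N ->
  exists cs al, [/\ size cs = 6, all (fun c => 0 < c) cs
    & weighted_frame cs path_vecs = al%:M + N].
Proof.
move=> Ns; have [B NB] := entries_bounded N.
pose al := 1 + 100 * B; pose M := al%:M + N.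
(* The coordinates of M in the basis of the matrices of path_vecs. At the
   identity they are 1/4, 1/4, 1/4, 3/8, 1/4, 1/8, and each perturbation is
   bounded by a few times B, so 100 leaves a wide margin. *)
pose c1 := M 2 2 / 4 + M 0 1 - M 0 2 / 2 + M 1 2 / 4.
pose c2 := M 2 2 / 4 - M 0 2 / 2 + M 1 2 / 4.
pose c3 := M 2 2 / 4 - M 0 2 / 2 - 3 / 4 * M 1 2.
pose c4 := M 0 0 - 5/8 * M 2 2 - M 0 1 + 3/4 * M 0 2 - 5/8 * M 1 2.
pose c5 := M 1 1 - 3/4 * M 2 2 - M 0 1 + 3/2 * M 0 2 + 1/4 * M 1 2.
pose c6 := M 2 2 / 8 + M 0 2 / 4 + M 1 2 / 8.
exists [:: c1; c2; c3; c4; c5; c6], al; split=> //.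
  rewrite /= /c1 /c2 /c3 /c4 /c5 /c6 /M !mxE /= !mulr0n !mulr1n !add0r /al.
  move: (NB 0 0) (NB 1 1) (NB 2 2) (NB 0 1) (NB 0 2) (NB 1 2).
  move: (N 0 0) (N 1 1) (N 2 2) (N 0 1) (N 0 2) (N 1 2) => a b c d e f.
  clear; by do 6!move=> /andP[? ?]; repeat (apply/andP; split); lra.
rewrite -/M; apply: sym3P; rewrite ?weighted_frame_sym ?scalar_add_sym//;
  rewrite weighted_frameE !big_ord_recl big_ord0 /= !vec3E;
  rewrite /c1 /c2 /c3 /c4 /c5 /c6;
  move: (M 0 0) (M 0 1) (M 0 2) (M 1 1) (M 1 2) (M 2 2) => a b c d e f;
  clear; lra.
Qed.

(** The four matrices of [claw_vecs] form a basis of the symmetric matrices whose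
entries (0,1) and (0,2) vanish. *)
Lemma claw_cone (N : 'M[R]_3) : N^T = N -> N 0 1 = 0 -> N 0 2 = 0 ->
  exists cs al, [/\ size cs = 4, all (fun c => 0 < c) cs
    & weighted_frame cs claw_vecs = al%:M + N].
Proof.
move=> Ns N01 N02; have [B NB] := entries_bounded N.
pose al := 1 + 100 * B; pose M := al%:M + N.
(* Likewise; the coordinates of the identity are 1/8, 1, 1/8, 3/4. *)
pose c1 := M 1 1 / 8 - M 1 2 / 4.
pose c2 := M 0 0.
pose c3 := M 1 1 / 8 + M 1 2 / 4.
pose c4 := M 2 2 - M 1 1 / 4.
have M01 : M 0 1 = 0 by rewrite /M !mxE N01 addr0.
have M02 : M 0 2 = 0 by rewrite /M !mxE N02 addr0.
exists [:: c1; c2; c3; c4], al; split=> //.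
  rewrite /= /c1 /c2 /c3 /c4 /M !mxE /= !mulr0n !mulr1n !add0r /al.
  move: (NB 0 0) (NB 1 1) (NB 2 2) (NB 0 1) (NB 0 2) (NB 1 2).
  move: (N 0 0) (N 1 1) (N 2 2) (N 0 1) (N 0 2) (N 1 2) => a b c d e f.
  clear; by do 6!move=> /andP[? ?]; repeat (apply/andP; split); lra.
rewrite -/M; apply: sym3P; rewrite ?weighted_frame_sym ?scalar_add_sym//;
  rewrite weighted_frameE !big_ord_recl big_ord0 /= !vec3E;
  rewrite /c1 /c2 /c3 /c4 ?M01 ?M02;
  move: (M 0 0) (M 0 1) (M 0 2) (M 1 1) (M 1 2) (M 2 2) => a b c d e f;
  clear; lra.
Qed.

End Vectors.

(** * Paths and claws in trees *)

Section Trees.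
Variables (n : nat) (T : sgraph n).
Implicit Types (S : {set 'I_n}) (s : seq 'I_n) (x y : 'I_n).

Definition within S : rel 'I_n := fun x y => [&& T x y, x \in S & y \in S].

Definition connected_on S : Prop :=
  {in S &, forall x y, connect (within S) x y}.

Lemma within_sym S : connect_sym (within S).
Proof.
apply: sym_connect_sym => x y.
by rewrite /within edge_sym [_ && (y \in S)]andbC.
Qed.

Lemma connect_within S x y : connect (within S) x y -> (x \in S) = (y \in S).
Proof.
by apply: closed_connect => a b /and3P[_ -> ->].
Qed.

(** Otherwise a simple path from a to b within S, closed by x, is a cycle. *)
Lemma acyclic_unique_nbr S x a b : acyclic T -> x \notin S -> a \in S ->
  T x a -> T x b -> connect (within S) a b -> a = b.
Proof.
move=> acT xS aS xa xb /connectP[p0 p0P bE]; move: bE.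
case/shortenP: p0P => p pP up _ bE.
have pS : all [in S] p.
  elim: p a pP {up bE aS xa} => //= z p IHp a /andP[/and3P[_ _ zS] /IHp].
  by rewrite zS.
case: p => [|z p] in pP up bE pS *; first by rewrite bE.
case: (acT [:: x, a, z & p]) => //; apply/andP; split.
  have Tp : path T a (z :: p) by apply: sub_path pP => ? ? /andP[].
  have lE : last x [:: a, z & p] = b := esym bE.
  by rewrite /cycle rcons_path lE edge_sym xb andbT [path _ _ _]/= xa.
rewrite cons_uniq up andbT; apply: contraNN xS.
by rewrite inE => /orP[/eqP->//|/(allP pS)].
Qed.

Lemma connected_on_ext S x y : connected_on S -> y \in S -> T x y ->
  connected_on (x |: S).
Proof.
move=> cS yS xy.
have to_y z : z \in x |: S -> connect (within (x |: S)) z y.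
  rewrite inE => /orP[/set1P->|zS].
    by apply: connect1; rewrite /within xy !inE eqxx yS orbT.
  have : connect (within S) z y by exact: cS.
  apply: connect_sub => a b /and3P[ab aS bS]; apply: connect1.
  by rewrite /within ab !inE aS bS !orbT.
move=> a b aS bS; apply: connect_trans (to_y a aS) _.
by rewrite within_sym; exact: to_y.
Qed.

Lemma sorted_connected_on s : sorted T s -> connected_on [set z in s].
Proof.
elim: s => [_ a b|x [|y s] IHs]; first by rewrite inE.
  by move=> _ a b; rewrite !inE => /eqP-> /eqP->.
case/andP=> xy ys; rewrite (_ : [set z in _] = x |: [set z in y :: s]).
  by apply: connected_on_ext xy; rewrite ?inE ?eqxx //; exact: IHs.
by apply/setP => z; rewrite !inE.
Qed.

(** Paths in an acyclic graph are induced: each vertex has only one neighbour in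
the connected set of the previous ones. *)
Lemma acyclic_path_adj s x0 k l : acyclic T -> sorted T s -> uniq s ->
  (k < l < size s)%N -> T (nth x0 s k) (nth x0 s l) = (l == k.+1).
Proof.
move=> acT sT us /andP[kl ls]; case: l kl ls => // l kl ls.
have adj m : (m.+1 < size s)%N -> T (nth x0 s m) (nth x0 s m.+1).
  by move/(sortedP x0): sT; apply.
apply/idP/idP => [kl1|/eqP[<-]]; last exact: adj.
have memS m : (m <= l)%N -> nth x0 s m \in [set z in take l.+1 s].
  move=> ml; rewrite inE -(nth_take x0 (ml : (m < l.+1)%N)) mem_nth// size_take.
  by rewrite ls ltnS.
have : nth x0 s k = nth x0 s l.
  apply: (@acyclic_unique_nbr [set z in take l.+1 s] (nth x0 s l.+1)) => //.
  - rewrite inE; apply/negP => /(nthP x0)[m]; rewrite size_take ls => ml.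
    rewrite nth_take// => /eqP; rewrite nth_uniq//; last exact: ltn_trans ls.
    by rewrite ltn_eqF.
  - exact: memS.
  - by rewrite edge_sym.
  - by rewrite edge_sym adj.
  - apply: sorted_connected_on; rewrite ?memS//.
    by rewrite take_sorted.
move/eqP; rewrite nth_uniq 1?eqSS 1?eq_sym //; last exact: ltnW.
exact: ltn_trans kl _.
Qed.

Lemma connected_exit S y0 :
  connected_graph T -> y0 \in S -> S != [set: 'I_n]%SET ->
  exists x y, [/\ x \notin S, y \in S & T x y].
Proof.
move=> [_ cT] y0S; apply: contra_neqP => noexit.
have Tsym : connect_sym T by apply: sym_connect_sym; exact: edge_sym.
have clS : closed T (mem S).
  apply: intro_closed => // a b ab aS; apply: contrapT => /negP bS.
  by apply: noexit; exists b, a; rewrite edge_sym.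
by apply/setP => z; rewrite inE -(closed_connect clS (cT y0 z)).
Qed.

Variant tree_shape : Prop :=
| SpanningPath s of sorted T s & uniq s & size s = n
| Claw a u b c of uniq [:: a; u; b; c] & T a u & T u b & T u c.

(** A simple path that misses some vertex has a neighbour x outside. If x is
adjacent to an end, the path can be lengthened; otherwise x and the two
neighbours on the path of the vertex adjacent to x form a claw. *)
Lemma path_or_claw : connected_graph T -> tree_shape.
Proof.
move=> cT; case: (cT) => n0 _; pose x0 : 'I_n := Ordinal n0.
have: sorted T [:: x0] by [].
have: uniq [:: x0] by [].
have: (0 < size [:: x0])%N by [].
have [N] := ubnP (n - size [:: x0]).
elim: N [:: x0] => // N IHN s szN s0 us sT.
have [/eqP sz|szn] := boolP (size s == n); first exact: SpanningPath sz.
have les : (size s <= n)%N.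
  by rewrite -(card_uniqP us) -[leqRHS]card_ord max_card.
have ltn' : (size s < n)%N by rewrite ltn_neqAle szn.
have [||x [y [xS yS xy]]] := @connected_exit [set z in s] (nth x0 s 0) cT.
- by rewrite inE mem_nth.
- apply: contraNneq szn => sE; rewrite -(card_uniqP us) -cardsE sE.
  by rewrite cardsT card_ord.
rewrite inE in xS; move: yS; rewrite inE => /(nthP x0)[k ks yE].
have [k0|k0] := posnP k.
  apply: (IHN (x :: s)); rewrite //=; [lia|by rewrite xS|].
  case: s sT {us szN s0 szn les ltn' xS ks} yE => //= z s ->.
  by rewrite k0 /= => ->; rewrite xy.
have [k1|k1] := eqVneq k.+1 (size s).
  apply: (IHN (rcons s x)); rewrite ?size_rcons ?rcons_uniq ?xS//; first lia.
  have: T (last x0 s) x by rewrite -nth_last -k1 /= yE edge_sym.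
  case: s sT {us szN s0 szn les ltn' xS ks yE k1} => //= z s.
  by rewrite rcons_path => -> ->.
have k1s : (k.+1 < size s)%N by rewrite ltn_neqAle k1 ks.
have adj m : (m.+1 < size s)%N -> T (nth x0 s m) (nth x0 s m.+1).
  by move/(sortedP x0): sT; apply.
apply: (@Claw (nth x0 s k.-1) y (nth x0 s k.+1) x).
- rewrite /= !inE -yE !nth_uniq ?negb_or ?(leq_ltn_trans (leq_pred k)) //.
  have nx m : (m < size s)%N -> nth x0 s m != x.
    by move=> ms; apply: contraNneq xS => <-; rewrite mem_nth.
  rewrite !nx ?(leq_ltn_trans (leq_pred k)) //; clear -k0; lia.
- by have := adj k.-1; rewrite prednK// yE; apply.
- by rewrite -yE adj.
- by rewrite edge_sym.
Qed.

Lemma spanning_mem s x : uniq s -> size s = n -> x \in s.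
Proof.
move=> us szs.
have e : #|s| = #|{: 'I_n}| by rewrite (card_uniqP us) szs card_ord.
by rewrite (elimT (subset_cardP e) (subset_predT _) x).
Qed.

Lemma spanning_path_isomorphic s m : acyclic T -> sorted T s -> uniq s ->
  size s = n -> size s = m -> isomorphic T (path_graph m).
Proof.
move=> acT sT us szs szm.
have s_all x : x \in s := spanning_mem x us szs.
have idx x : (index x s < m)%N by rewrite -szm index_mem.
pose f x : 'I_m := Ordinal (idx x).
have f_inj : injective f.
  move=> x y /(congr1 val) /= e.
  by rewrite -(nth_index x (s_all x)) e nth_index.
exists f; first by apply: inj_card_bij => //; rewrite !card_ord -szs szm.
move=> x y; rewrite /= /path_rel /=.
have adj a b : (index a s < index b s)%N ->
    T a b = (index b s == (index a s).+1).
  by move=> ab; rewrite -(@acyclic_path_adj s x) ?nth_index ?ab ?index_mem //=.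
case: (ltngtP (index x s) (index y s)) => [xy|yx|xy].
- rewrite adj// [RHS]eq_sym orbC gtn_eqF// ltnW//.
- rewrite edge_sym adj// [RHS]eq_sym gtn_eqF// ltnW//.
- have -> : x = y by apply: f_inj; exact: val_inj.
  by rewrite edge_irrefl gtn_eqF.
Qed.
End Trees.

(** * Orthogonal representations of trees *)

Section OrthogonalRepresentations.
Variables (R : realType) (n : nat) (T : sgraph n).
Implicit Types (S : {set 'I_n}) (v : 'I_n -> 'rV[R]_3).

(** Besides orthogonality, the vectors are asked to be pairwise independent, so
that no plane orthogonal to one of them is orthogonal to another. *)
Definition orthorep S v : Prop := {in S &, forall x y, x != y ->
  cross (v x) (v y) != 0 /\ (dot (v x) (v y) == 0) = T x y}.

Lemma cross_neq0C (u v : 'rV[R]_3) : (cross v u != 0) = (cross u v != 0).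
Proof. by rewrite crossC oppr_eq0. Qed.

(** The new vector is v_y x g, orthogonal to v_y. Its product with v_a is that of
v_a x v_y with g, nonzero for a generic g when a differs from y, as it must be
since y is the only neighbour of x in S. *)
Lemma orthorep_ext S v x y : acyclic T -> connected_on T S ->
  (1 < #|S|)%N -> orthorep S v -> x \notin S -> y \in S -> T x y ->
  exists u, orthorep (x |: S) (fun z => if z == x then u else v z).
Proof.
move=> acT cS S1 vS xS yS xy.
have [z] : exists z, z \in S :\ y.
  by apply/card_gt0P; move: S1; rewrite (cardsD1 y) yS.
rewrite in_setD1 => /andP[zy zS].
have v0 a : a \in S -> v a != 0.
  move=> aS; apply/negP => /eqP va0.
  have nocross b : cross (v a) (v b) = 0 by rewrite va0 cross0v.
  have [ay|ay] := eqVneq a y.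
    have [] := vS a z aS zS; first by rewrite ay eq_sym.
    by rewrite nocross eqxx.
  by have [] := vS a y aS yS ay; rewrite nocross eqxx.
pose us := [seq v a | a in S] ++ [seq cross (v a) (v y) | a in S :\ y].
have [|g gP] := @generic_vector R 3 us.
  move=> u; rewrite mem_cat => /orP[] /mapP[a]; rewrite mem_enum => aS ->.
    exact: v0.
  by move: aS; rewrite in_setD1 => /andP[ay aS]; have [] := vS a y aS yS ay.
have gv a : a \in S -> dot (v a) g != 0.
  by move=> aS; apply: gP; rewrite mem_cat map_f ?mem_enum.
have gc a : a \in S -> a != y -> dot (cross (v y) g) (v a) != 0.
  move=> aS ay; rewrite dot_cross_rot; apply: gP.
  rewrite mem_cat; apply/orP; right.
  apply: (map_f (fun a => cross (v a) (v y))).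
  by rewrite mem_enum in_setD1 ay.
pose u := cross (v y) g; exists u.
have u0 : u != 0.
  by apply: contraNneq (gc z zS zy); rewrite -/u => ->; rewrite /dot mul0mx mxE.
have uS a : a \in S -> cross u (v a) != 0 /\ (dot u (v a) == 0) = T x a.
  move=> aS; split; first by rewrite cross_cross_neq0 ?gv.
  have [->|ay] := eqVneq a y; first by rewrite dotC dot_cross_self eqxx xy.
  rewrite (negPf (gc a aS ay)); apply/esym/negP => xa; case/eqP: ay.
  by apply/esym/(acyclic_unique_nbr acT xS yS xy xa); exact: cS.
move=> a b /setU1P[->|aS] /setU1P[->|bS]; rewrite ?eqxx // => ab.
- by rewrite [b == x]eq_sym (negPf ab); exact: uS.
- by rewrite (negPf ab) cross_neq0C dotC edge_sym; exact: uS.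
- rewrite !ifN; first exact: vS.
    by apply: contraNneq xS => <-.
  by apply: contraNneq xS => <-.
Qed.

Lemma orthorep_total S v :
  connected_graph T -> acyclic T -> connected_on T S ->
  (1 < #|S|)%N -> orthorep S v ->
  exists2 v', {in S, v' =1 v} & orthorep [set: 'I_n] v'.
Proof.
move=> cT acT; have [N] := ubnP #|~: S|.
elim: N S v => // N IHN S v SN cS S1 vS.
have [ST|SnT] := eqVneq S [set: 'I_n]%SET; first by exists v; rewrite -?ST.
have [y0 y0S] : exists y, y \in S by apply/card_gt0P; exact: ltnW.
have [x [y [xS yS xy]]] := connected_exit cT y0S SnT.
have [u uS] := orthorep_ext acT cS S1 vS xS yS xy.
have N_bound : (#|~: (x |: S)| < N)%N.
  move: SN; rewrite [X in (X < _)%N -> _](cardsD1 x) finset.in_setC xS ltnS.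
  apply: leq_trans.
  by apply/subset_leq_card/fintype.subsetP => z; rewrite !inE negb_or.
have S1' : (1 < #|x |: S|)%N by rewrite cardsU1 xS ltnS ltnW.
have [v' v'E v'T] := IHN _ _ N_bound (connected_on_ext cS yS xy) S1' uS.
exists v' => // a aS; rewrite v'E ?inE ?aS ?orbT//.
by case: eqP aS xS => [->->|].
Qed.

(** The vertices of [s] are given the vectors [vs]; the representation is then
extended to the whole tree, with weight 1 outside of [s]. The matrix [E] is what
the vertices outside of [s] contribute to the frame operator. *)
Lemma q_compl_of_base (s : seq 'I_n) (vs : seq 'rV[R]_3) (b : bool) :
  connected_graph T -> acyclic T -> uniq s -> (1 < size s)%N ->
  size vs = size s -> connected_on T [set x in s] ->
  (forall x0 k l, (k < l < size s)%N -> cross vs`_k vs`_l != 0 /\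
      (dot vs`_k vs`_l == 0) = T (nth x0 s k) (nth x0 s l)) ->
  (forall E : 'M[R]_3, E^T = E -> exists (cs : seq R) al (w : 'rV[R]_3),
    [/\ size cs = size vs, all (fun c => 0 < c) cs, (w != 0) ==> b
      & weighted_frame cs vs + E = al%:M + w^T *m w]) ->
  (q_graph R (compl T) <= 2 + b)%N.
Proof.
move=> cT acT us s1 szv cS vsP cone.
pose v0 x := vs`_(index x s).
have v0P x y : x \in s -> y \in s -> (index x s < index y s)%N ->
    cross (v0 x) (v0 y) != 0 /\ (dot (v0 x) (v0 y) == 0) = T x y.
  move=> xs ys xy; have := vsP x (index x s) (index y s).
  by rewrite xy index_mem ys !nth_index//; apply.
have v0S : orthorep [set x in s] v0.
  move=> x y; rewrite !inE => xs ys xny.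
  case: (ltngtP (index x s) (index y s)) => [xy|yx|xy]; first exact: v0P.
    by rewrite cross_neq0C dotC edge_sym; exact: v0P.
  by case/eqP: xny; rewrite -(nth_index x xs) xy nth_index.
have [|v vE vT] := orthorep_total cT acT cS _ v0S.
  by rewrite cardsE (card_uniqP us).
pose E : 'M[R]_3 := \sum_(i | i \notin s) (v i)^T *m v i.
have [|cs [al [w [szc cs0 wb frameE]]]] := cone E.
  rewrite /E raddf_sum; apply: eq_bigr => i _ /=.
  by rewrite trmx_mul trmxK.
(* The index of a vertex outside of s is size s, so the default value 1 is its
   weight. *)
pose c x := nth 1 cs (index x s).
apply: (@leq_trans (2 + (w != 0%R))); last first.
  by rewrite leq_add2l; case: (w != 0) wb => //= ->.
apply: (@q_graph_frame R n (compl T) 3 v c al w).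
- move=> i j ij.
  have [_ vij] := vT i j (finset.in_setT i) (finset.in_setT j) ij.
  by rewrite vij /= /compl_rel ij.
- move=> i; rewrite /c; have [is_|is_] := ltnP (index i s) (size cs).
    by move/all_nthP: cs0; apply.
  by rewrite nth_default.
- rewrite -frameE (bigID (mem s)) /=; congr (_ + _); last first.
    apply: eq_bigr => i is_; rewrite /c nth_default ?scale1r//.
    by rewrite szc szv leqNgt index_mem.
  rewrite -big_uniq//= /weighted_frame szv.
  have [x0 _] : exists x0, x0 \in s.
    by case: (s) s1 => // z s' _; exists z; exact: mem_head.
  rewrite (big_nth x0) big_mkord; apply: eq_bigr => k _.
  rewrite /c index_uniq// (set_nth_default 0) ?szc ?szv//.
  rewrite vE ?inE ?mem_nth//.
  by rewrite /v0 index_uniq.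
Qed.
End OrthogonalRepresentations.

(** * The two bases *)

Section Bases.
Variable R : realType.

Lemma cross_neq0_coords (u v : 'rV[R]_3) :
  ~ [/\ u 0 1 * v 0 2 - u 0 2 * v 0 1 = 0, u 0 2 * v 0 0 - u 0 0 * v 0 2 = 0
    & u 0 0 * v 0 1 - u 0 1 * v 0 0 = 0] -> cross u v != 0.
Proof.
move=> uv; apply/eqP => uv0; apply: uv.
by have [<- <- <-] := crossE u v; rewrite uv0 !mxE.
Qed.

Lemma path_vecsP k l : (k < l < 6)%N ->
  cross (path_vecs R)`_k (path_vecs R)`_l != 0 /\
  (dot (path_vecs R)`_k (path_vecs R)`_l == 0) = (l == k.+1).
Proof.
case/andP=> kl; case: l kl => [|[|[|[|[|[|l]]]]]] //;
  case: k => [|[|[|[|[|k]]]]] //= _ _;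
  (split; first by apply: cross_neq0_coords; rewrite !vec3E; case; lra).
all: rewrite dot3E !vec3E.
all: by case: eqP => // e; first [exfalso; lra | case: e; lra].
Qed.

Lemma claw_vecsP k l : (k < l < 4)%N ->
  cross (claw_vecs R)`_k (claw_vecs R)`_l != 0 /\
  (dot (claw_vecs R)`_k (claw_vecs R)`_l == 0) = (k == 1)%N || (l == 1)%N.
Proof.
case/andP=> kl; case: l kl => [|[|[|[|l]]]] //;
  case: k => [|[|[|k]]] //= _ _;
  (split; first by apply: cross_neq0_coords; rewrite !vec3E; case; lra).
all: rewrite dot3E !vec3E.
all: by case: eqP => // e; first [exfalso; lra | case: e; lra].
Qed.
End Bases.

(** * Bounds on q *)

Section Bounds.
Variables (R : realType) (n : nat) (T : sgraph n).

Lemma q_compl_long_path s : connected_graph T -> acyclic T ->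
  sorted T s -> uniq s -> size s = 6 ->
  (q_graph R (compl T) <= 2)%N.
Proof.
move=> cT acT sT us s6.
apply: (@q_compl_of_base R n T s (path_vecs R) false); rewrite ?s6 //.
- exact: sorted_connected_on.
- move=> x0 k l kl; rewrite acyclic_path_adj ?s6//; exact: path_vecsP.
- move=> E Es; have [|cs [al [szc cs0 frameE]]] := @path_cone R (- E).
    by rewrite linearN /= Es.
  exists cs, al, 0; split=> //; first by rewrite eqxx.
  by rewrite frameE mulmx0 addr0 subrK.
Qed.

Lemma acyclic_no_triangle u x y :
  acyclic T -> T u x -> T u y -> x != y -> ~~ T x y.
Proof.
move=> acT ux uy xny; apply/negP => xy; case/eqP: xny.
have ne a b : T a b -> a != b by apply: contraTneq => ->; rewrite edge_irrefl.
apply: (@acyclic_unique_nbr n T [set x; y] u) => //.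
- by rewrite !inE negb_or !ne.
- by rewrite !inE eqxx.
- by apply: connect1; rewrite /within xy !inE !eqxx orbT.
Qed.

Lemma q_compl_claw a u b c : connected_graph T -> acyclic T ->
  uniq [:: a; u; b; c] ->
  T a u -> T u b -> T u c -> (q_graph R (compl T) <= 3)%N.
Proof.
move=> cT acT us au ub uc.
apply: (@q_compl_of_base R n T [:: a; u; b; c] (claw_vecs R) true) => //.
- rewrite (_ : [set x in _] = c |: [set x in [:: a; u; b]]).
    apply: (@connected_on_ext _ _ _ _ u); rewrite ?inE ?eqxx ?orbT//.
      by apply: sorted_connected_on; rewrite /= au ub.
    by rewrite edge_sym.
  by apply/setP => z; rewrite !inE; case: (z == c); rewrite ?orbT ?orbF.
- move=> x0 k l kl; have [kl0 ->] := claw_vecsP R kl; split=> // {kl0}.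
  move: us; rewrite /= !inE !negb_or andbT.
  move=> /andP[/and3P[anu anb anc] /andP[/andP[unb unc] bnc]].
  have ua : T u a by rewrite edge_sym.
  case/andP: kl => kl; case: l kl => [|[|[|[|l]]]] //;
  case: k => [|[|[|k]]] //= _ _.
  + by rewrite (negPf (acyclic_no_triangle acT ua ub anb)).
  + by rewrite (negPf (acyclic_no_triangle acT ua uc anc)).
  + by rewrite (negPf (acyclic_no_triangle acT ub uc bnc)).
- move=> E Es.
  pose w := vec3 1 (E 0 1) (E 0 2).
  pose N := w^T *m w - E.
  have [|||cs [al [szc cs0 frameE]]] := @claw_cone R N.
  + by rewrite /N linearB /= trmx_mul trmxK Es.
  + by rewrite /N !mxE big_ord1 !mxE /= mul1r subrr.
  + by rewrite /N !mxE big_ord1 !mxE /= mul1r subrr.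
  exists cs, al, w; split=> //; first exact: implybT.
  by rewrite frameE /N addrA subrK.
Qed.

(** The leaves span a complete graph in the complement, the pattern of a matrix
of rank one, which is a Gram matrix in dimension 1. *)
Lemma q_compl_star u : (forall x y, x != y -> T x y = (x == u) || (y == u)) ->
  (q_graph R (compl T) <= 2)%N.
Proof.
move=> star; pose v (x : 'I_n) : 'rV[R]_1 := (x != u)%:R%:M.
pose F := \sum_x 1 *: ((v x)^T *m v x).
have := @q_graph_frame R n (compl T) 1 v (fun=> 1) (F 0 0) 0.
rewrite eqxx addn0; apply=> [x y xy|//|]; last first.
  by rewrite mulmx0 addr0 -mx11_scalar.
rewrite /= /compl_rel xy star//= negb_or /dot /v tr_scalar_mx -scalar_mxM.
rewrite mxE /= mulr1n.
by rewrite -natrM pnatr_eq0 mulnb eqb0 negbK.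
Qed.

(** The matrix [A] is the Laplacian of T - u, bordered by minus the adjacency
vector of u, with 0 at u. The row [y d], difference of the indicators of the
branches at u through [a] and through [d], is killed by the Laplacian as it is
constant on each branch, and by the column of u as each of the two branches has
exactly one neighbour of u. *)
Lemma q_lt_order_of_claw a u b c : acyclic T -> uniq [:: a; u; b; c] ->
  T a u -> T u b -> T u c -> (q_graph R T < n)%N.
Proof.
move=> acT us au ub uc; pose W := within T (~: [set u]).
have ua : T u a by rewrite edge_sym.
have uW : u \notin ~: [set u] by rewrite !inE eqxx.
have nW x : T u x -> x \in ~: [set u].
  by move=> ux; rewrite !inE; apply: contraTneq ux => ->; rewrite edge_irrefl.
have Wnbr x y : T u x -> T u y -> connect W x y = (x == y).
  move=> ux uy; apply/idP/eqP => [|->]; last exact: connect0.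
  exact: (acyclic_unique_nbr acT uW (nW x ux) ux uy).
have Wu x : T u x -> connect W x u = false.
  move=> ux; apply/negP => /connect_within.
  by rewrite (nW x ux) (negPf uW).
pose deg x := #|[set y | T x y & y != u]|.
pose A : 'M[R]_n := \matrix_(i, j)
  (((i == j) && (i != u))%:R * (deg i)%:R - (T i j)%:R).
have GA : S_graph R T A.
  split=> [|i j ij].
    apply/matrixP => i j; rewrite !mxE edge_sym eq_sym.
    by case: eqP => [->//|_]; rewrite !mul0r.
  by rewrite mxE (negPf ij) mul0r sub0r oppr_eq0 pnatr_eq0 eqb0 negbK.
pose y (d : 'I_n) : 'rV[R]_n :=
  \row_i ((connect W a i)%:R - (connect W d i)%:R).
have yA d : T u d -> y d *m A = 0.
  move=> ud; apply/rowP => j; rewrite !mxE.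
  transitivity (y d 0 j * ((j != u)%:R * (deg j)%:R)
      - \sum_(i | T j i) y d 0 i).
    rewrite (eq_bigr (fun i =>
      y d 0 i * (((i == j) && (i != u))%:R * (deg i)%:R)
        - y d 0 i * (T j i)%:R)); last first.
      by move=> i _; rewrite [A i j]mxE mulrBr [T i j]edge_sym.
    rewrite sumrB; congr (_ - _).
      rewrite (bigD1 j)//= eqxx big1 ?addr0// => i ij.
      by rewrite (negPf ij) mul0r mulr0.
    rewrite [RHS]big_mkcond; apply: eq_bigr => i _.
    by case: (T j i); rewrite ?mulr1 ?mulr0.
  have [->|ju] := eqVneq j u.
    rewrite mul0r mulr0 sub0r.
    rewrite (eq_bigr (fun i => (a == i)%:R - (d == i)%:R)); last first.
      by move=> i ui; rewrite mxE !Wnbr.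
    have sum1 e : T u e -> \sum_(i | T u i) (e == i)%:R = 1 :> R.
      move=> ue; rewrite (bigD1 e)//= eqxx big1 ?addr0// => i /andP[_ ie].
      by rewrite eq_sym (negPf ie).
    by rewrite sumrB !sum1// subrr oppr0.
  have yu : y d 0 u = 0 by rewrite mxE !Wu// subrr.
  have step i : T j i -> i != u -> y d 0 i = y d 0 j.
    move=> ji iu; have jiW : connect W j i.
      by apply: connect1; rewrite /W /within ji !inE ju iu.
    by rewrite !mxE !(same_connect_r (@within_sym n T _) jiW).
  rewrite mul1r (bigID (fun i => i == u)) /= big1 ?add0r; last first.
    by move=> i /andP[_ /eqP->].
  rewrite (eq_bigr (fun=> y d 0 j)); last by move=> i /andP[]; exact: step.
  rewrite sumr_const mulr_natr; apply/eqP; rewrite subr_eq0; apply/eqP.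
  congr (_ *+ _).
  by apply: eq_card => i; rewrite !inE.
have rankA : (1 < \rank (eigenspace A 0))%N.
  pose e (k : 'I_2) := if k == 0 then b else c.
  pose Y : 'M[R]_(2, n) := \matrix_k y (e k).
  (* On the columns b and c the two rows of Y form minus the identity. *)
  pose D : 'M[R]_(n, 2) := \matrix_(i, k) (i == e k)%:R.
  have ue k : T u (e k) by rewrite /e; case: ifP.
  have ea k : e k != a.
    move: us; rewrite /= !inE !negb_or /e.
    by case: ifP => _ /andP[/and3P[_ ab ac]] _; rewrite eq_sym.
  have e_inj k l : (e k == e l) = (k == l).
    have bc : b != c by move: us; rewrite /= !inE => /and3P[_ _ /andP[]].
    case: k => [[|[|//]] k2]; case: l => [[|[|//]] l2]; rewrite /e /= ?eqxx//.
      by rewrite (negPf bc).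
    by rewrite eq_sym (negPf bc).
  have YD : Y *m D = - 1%:M.
    apply/matrixP => k l; rewrite !mxE (bigD1 (e l))//= !mxE eqxx mulr1 big1.
      by rewrite addr0 !Wnbr// eq_sym (negPf (ea l)) sub0r e_inj.
    by move=> i /negPf il; rewrite [D _ _]mxE il mulr0.
  have YA : (Y <= eigenspace A 0)%MS.
    apply/eigenspaceP; rewrite scale0r; apply/row_matrixP => k.
    by rewrite row_mul rowK yA// row0.
  apply: leq_trans (mxrankS YA); apply: leq_trans (mxrankM_maxl Y D).
  by rewrite YD mxrank_opp mxrank1.
have A0 : eigenvalue A 0 by rewrite /eigenvalue -mxrank_eq0 -lt0n ltnW.
apply: leq_ltn_trans (q_graph_le GA) _.
rewrite -ltnS; apply: leq_trans (q_mx_eigenspaces A0).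
by rewrite -addn2 leq_add2l.
Qed.
End Bounds.

Theorem theorem5p2 (R : realType) (n : nat) (T : sgraph n)
    (T_tree : is_tree T)
    (T_not_P4 : ~ isomorphic T (path_graph 4))
    (T_not_P5 : ~ isomorphic T (path_graph 5)) :
  (q_graph R T + q_graph R (compl T) <= order_of T + 2)%N.
Proof.
case: T_tree => cT acT; rewrite /order_of.
have qT := q_graph_le_order R T; have qTc := q_graph_le_order R (compl T).
case: (path_or_claw cT) => [s sT us szs|a u b c abc au ub uc]; last first.
  have := q_lt_order_of_claw R acT abc au ub uc.
  have := q_compl_claw R cT acT abc au ub uc; lia.
have [n6|n6] := leqP 6 n.
  suff : (q_graph R (compl T) <= 2)%N by lia.
  apply: (@q_compl_long_path R n T (take 6 s));
    rewrite ?take_sorted ?take_uniq//.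
  by rewrite size_takel // szs.
have n4 : n <> 4.
  move=> n4; apply: T_not_P4.
  exact: (spanning_path_isomorphic acT sT us szs (etrans szs n4)).
have n5 : n <> 5.
  move=> n5; apply: T_not_P5.
  exact: (spanning_path_isomorphic acT sT us szs (etrans szs n5)).
have [n3|n3] := eqVneq n 3; last lia.
suff : (q_graph R (compl T) <= 2)%N by lia.
have s_all x := spanning_mem x us szs.
case: s sT us {szs} (etrans szs n3) s_all => [|x [|u [|z []]]] // sT us _ s_all.
have /= adj := @acyclic_path_adj n T [:: x; u; z] x _ _ acT sT us.
have [xu uz xz] : [/\ T x u, T u z & T x z = false].
  by split;
    [have /= -> := adj 0 1|have /= -> := adj 1 2|have /= -> := adj 0 2].
move: us => /= /and3P[]; rewrite !inE !negb_or.
move=> /andP[/negPf xnu xnz] /negPf unz _.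
apply: (@q_compl_star R n T u) => a b; move: (s_all a) (s_all b); rewrite !inE.
by do 2![case/or3P=> /eqP->]; rewrite ?eqxx ?orbT //;
  rewrite ?xnu ?unz ?[z == u]eq_sym ?unz // edge_sym.
Qed.
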